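(* Let $n$ be a positive integer. If $G$ is a connected $n$-vertex graph that is not isomorphic to $K_n$ or $P_3$, then $\mathcal{E}_3^{-}(G)\geq n$.
   Context: All graphs are finite and simple. $K_n$ is the complete graph on $n$ vertices and $P_3$ is the path on $3$ vertices. For an $n$-vertex graph $G$, let $\lambda_1(G)\geq\cdots\geq\lambda_n(G)$ be the eigenvalues (with multiplicity) of its adjacency matrix. The negative $3$-energy of $G$ is $\mathcal{E}^-_3(G)=\sum_{i:\lambda_i(G)<0}|\lambda_i(G)|^3$. *)

(* Defs.v *)
From HB Require Import structures.
From mathcomp Require Import all_boot all_order all_algebra.
From mathcomp Require Import polyrcf complex.

Set Implicit Arguments.
Unset Strict Implicit.
Unset Printing Implicit Defensive.

Import Order.TTheory GRing.Theory Num.Theory.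
Local Open Scope ring_scope.

Record sgraph := SGraph {
  vertex :> finType;
  adj : rel vertex;
  adj_sym : symmetric adj;
  adj_irrefl : irreflexive adj }.

Definition connected_graph (G : sgraph) : Prop :=
  forall x y : G, connect (@adj G) x y.

Definition graph_iso (G H : sgraph) : Prop :=
  exists2 f : G -> H, bijective f & forall x y : G, adj (f x) (f y) = adj x y.

Definition complete_rel n : rel 'I_n := fun i j => i != j.

Lemma complete_sym n : symmetric (@complete_rel n).
Proof. by move=> i j; rewrite /complete_rel eq_sym. Qed.

Lemma complete_irrefl n : irreflexive (@complete_rel n).
Proof. by move=> i; rewrite /complete_rel eqxx. Qed.

Definition complete_graph n : sgraph :=
  SGraph (@complete_sym n) (@complete_irrefl n).

Definition path_rel n : rel 'I_n := fun i j => (i.+1 == j) || (j.+1 == i).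

Lemma path_sym n : symmetric (@path_rel n).
Proof. by move=> i j; rewrite /path_rel orbC. Qed.

Lemma path_irrefl n : irreflexive (@path_rel n).
Proof. by move=> i; rewrite /path_rel orbb gtn_eqF. Qed.

Definition path_graph n : sgraph :=
  SGraph (@path_sym n) (@path_irrefl n).

Definition adj_mx (R : pzRingType) (G : sgraph) : 'M[R]_#|G| :=
  \matrix_(i, j) (adj (enum_val i) (enum_val j))%:R.

(* For a symmetric matrix this is the whole spectrum: see
   [char_poly_eigenvalues] and [size_eigenvalues]. *)
Definition eigenvalues (R : rcfType) n (A : 'M[R]_n) : seq R :=
  let p := char_poly A in
  sort >=%R (flatten [seq nseq (mup x p) x | x <- rootsR p]).

Definition neg_energy (R : rcfType) (p : nat) (G : sgraph) : R :=
  \sum_(x <- eigenvalues (adj_mx R G) | x < 0) `|x| ^+ p.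

Lemma adj_mx_sym (R : pzRingType) (G : sgraph) : (adj_mx R G)^T = adj_mx R G.
Proof. by apply/matrixP => i j; rewrite !mxE adj_sym. Qed.

Lemma sorted_eigenvalues (R : rcfType) n (A : 'M[R]_n) :
  sorted >=%R (eigenvalues A).
Proof. by apply: sort_sorted => x y; rewrite /= orbC le_total. Qed.

Lemma perm_eigenvalues (R : rcfType) n (A : 'M[R]_n) (s : seq R) :
  char_poly A = \prod_(x <- s) ('X - x%:P) -> perm_eq (eigenvalues A) s.
Proof.
move=> Ap; rewrite /eigenvalues perm_sort.
have p0 : char_poly A != 0 by rewrite monic_neq0 ?char_poly_monic.
have memr x : (x \in rootsR (char_poly A)) = (x \in s).
  have /(_ x) := roots_on_rootsR p0; rewrite in_itv /= => <-.
  by rewrite Ap root_prod_XsubC.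
have ur : uniq (rootsR (char_poly A)).
  exact: (sorted_uniq lt_trans lt_irreflexive (sorted_roots _ _ _)).
apply/allP => x _ /=; apply/eqP.
rewrite count_flatten -map_comp.
have -> : count_mem x s = mup x (char_poly A) by rewrite Ap mu_prod_XsubC.
rewrite (eq_map (g := fun y => ((y == x) * mup y (char_poly A))%N)); last first.
  by move=> y /=; rewrite count_nseq.
rewrite sumnE big_map.
case: (boolP (x \in rootsR (char_poly A))) => xr.
  rewrite (bigD1_seq x) //= eqxx mul1n big1 ?addn0 // => y /negPf ->.
  by rewrite mul0n.
rewrite big_seq big1.
  rewrite mupNroot //; move: xr; rewrite memr.
  by rewrite Ap root_prod_XsubC.
by move=> y yr; case: eqP => [yx|//]; rewrite yx (negPf xr) in yr.
Qed.

Lemma sym_char_poly_split (R : rcfType) n (A : 'M[R]_n) : A^T = A ->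
  exists s : seq R, char_poly A = \prod_(x <- s) ('X - x%:P).
Proof.
move=> symA; pose f := real_complex R; pose B := map_mx f A.
have Bsym : B \is symmetricmx.
  by apply/is_hermitianmxP; rewrite expr0 scale1r map_mx_id // map_trmx symA.
have Breal : B \is a mxOver Num.real.
  by apply/mxOverP => i j; rewrite mxE; apply/complex_realP; exists (A i j).
have Bherm := realsym_hermsym Bsym Breal.
have /orthomx_spectralP BE := hermitian_normalmx Bherm.
have Dreal := hermitian_spectral_diag_real Bherm.
set P := spectralmx B in BE; set d := spectral_diag B in BE Dreal.
have uP : P \in unitmx by apply: spectral_unit.
exists [seq complex.Re (d 0 i) | i <- enum 'I_n].
apply: (map_poly_inj f); rewrite map_char_poly -/B.
have -> : char_poly B = char_poly (diag_mx d).
  rewrite BE /char_poly /char_poly_mx !map_mxM /=.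
  pose Q := map_mx polyC P; pose Q' := map_mx polyC (invmx P).
  have Q'Q : Q' *m Q = 1%:M by rewrite -map_mxM mulVmx // map_mx1.
  have -> : 'X%:M - Q' *m map_mx polyC (diag_mx d) *m Q =
            Q' *m ('X%:M - map_mx polyC (diag_mx d)) *m Q.
    by rewrite mulmxBr mulmxBl scalar_mxC -[in RHS](mulmxA _ Q') Q'Q mulmx1.
  by rewrite !det_mulmx mulrAC -det_mulmx Q'Q det1 mul1r.
rewrite char_poly_trig ?diag_mx_is_trig // rmorph_prod big_map big_enum /=.
apply: eq_bigr => i _; rewrite rmorphB /= map_polyX map_polyC /=.
by rewrite mxE eqxx mulr1n RRe_real // (mxOverP Dreal).
Qed.

Lemma char_poly_eigenvalues (R : rcfType) n (A : 'M[R]_n) : A^T = A ->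
  char_poly A = \prod_(x <- eigenvalues A) ('X - x%:P).
Proof.
move=> /sym_char_poly_split[s Ap]; rewrite [LHS]Ap; apply: perm_big.
by rewrite perm_sym; apply: perm_eigenvalues.
Qed.

Lemma size_eigenvalues (R : rcfType) n (A : 'M[R]_n) : A^T = A ->
  size (eigenvalues A) = n.
Proof.
move=> /char_poly_eigenvalues/(congr1 (size \o polyseq))/=.
by rewrite size_char_poly size_prod_XsubC => -[].
Qed.

(* Main.v *)
(* Let G' be obtained from a graph G by adding a vertex with d >= 1 neighbours.
   The negative 3-energy grows by at least 1.  Write D(h) for the sum of h over
   the spectrum of G' minus its sum over the spectrum of G; then D(x) = 0,
   D(x^2) = 2d and D(x^3) <= 3d(d-1).  By interlacing, D(h) >= inf h for monotone
   h, hence D(h) >= h(a) when h decreases up to a and increases after a.  With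
   n = max(-x,0), p = max(x,0) and g(s) = 2s^3 - 3s^2 this gives
     D(n^3 - 3n) >= -2,  D(g(n)) >= -1,  D(g(p-d+1)) >= g(1-d) - 1.
   If D(n) >= 1, the first inequality gives D(n^3) >= 1; if D(n) <= 1, so does the
   sum of 2d-1 times the second and of the third.
   A connected graph that is neither complete nor P_3 contains a connected
   non-complete graph on 4 vertices, whose energy is at least 4, and the
   other vertices can be added one at a time, each adjacent to an earlier one. *)

Require Import Defs.
From mathcomp Require Import all_boot all_order all_algebra reals.
From mathcomp Require Import perm polyrcf complex ring lra.

Set Implicit Arguments.
Unset Strict Implicit.
Unset Printing Implicit Defensive.

Import Order.TTheory GRing.Theory Num.Theory.
Local Open Scope ring_scope.
Local Open Scope sesquilinear_scope.
Local Open Scope complex_scope.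

(** * Spectral decomposition of real symmetric matrices *)

Lemma char_poly_similar (F : comUnitRingType) n (P A : 'M[F]_n) :
  P \in unitmx -> char_poly (invmx P *m A *m P) = char_poly A.
Proof.
move=> uP; rewrite /char_poly /char_poly_mx !map_mxM /=.
set Q := map_mx polyC P; set Q' := map_mx polyC (invmx P).
have Q'Q : Q' *m Q = 1%:M by rewrite -map_mxM mulVmx // map_mx1.
have -> : 'X%:M - Q' *m map_mx polyC A *m Q =
          Q' *m ('X%:M - map_mx polyC A) *m Q.
  by rewrite mulmxBr mulmxBl scalar_mxC -[in RHS](mulmxA _ Q') Q'Q mulmx1.
by rewrite !det_mulmx mulrAC -det_mulmx Q'Q det1 mul1r.
Qed.

(* The eigenbasis is taken over R[i], where the library has the spectral theorem. *)
Definition spectral_dec (R : rcfType) n (A : 'M[R]_n) (P : 'M[R[i]]_n)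
    (d : 'I_n -> R) :=
  [/\ P \is unitarymx,
      map_mx (real_complex R) A = P^t* *m diag_mx (\row_i (d i)%:C) *m P
    & perm_eq (eigenvalues A) [seq d i | i <- enum 'I_n]].

(** Over [R[i]] a real symmetric matrix is hermitian, hence unitarily diagonalizable with a real
    diagonal. Conjugation preserves the characteristic polynomial, which identifies the diagonal
    with [eigenvalues A] up to order. *)
Lemma spectral_decP (R : rcfType) n (A : 'M[R]_n) :
  A^T = A -> exists P d, spectral_dec A P d.
Proof.
move=> symA; pose f := real_complex R; pose B := map_mx f A.
have Bsym : B \is symmetricmx.
  by apply/is_hermitianmxP; rewrite expr0 scale1r map_mx_id // map_trmx symA.
have Breal : B \is a mxOver Num.real.
  by apply/mxOverP => i j; rewrite mxE; apply/complex_realP; exists (A i j).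
have Bherm := realsym_hermsym Bsym Breal.
have /orthomx_spectralP BE := hermitian_normalmx Bherm.
have Dreal := hermitian_spectral_diag_real Bherm.
set P := spectralmx B in BE; set D := spectral_diag B in BE Dreal.
have uP : P \is unitarymx by apply: spectral_unitarymx.
pose d i := complex.Re (D 0 i).
have DE : D = \row_i (d i)%:C.
  by apply/rowP => i; rewrite mxE RRe_real // (mxOverP Dreal).
exists P, d; split=> //; first by rewrite -invmx_unitary // -DE.
apply: perm_eigenvalues; apply: (map_poly_inj f); rewrite map_char_poly -/B.
rewrite BE char_poly_similar ?unitarymx_unit // char_poly_trig ?diag_mx_is_trig //.
rewrite rmorph_prod big_map big_enum /=; apply: eq_bigr => i _.
by rewrite rmorphB /= map_polyX map_polyC /= mxE eqxx mulr1n DE mxE.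
Qed.

Lemma eigenvalues_sum (R : rcfType) n (A : 'M[R]_n) P d (h : R -> R) :
  spectral_dec A P d -> \sum_(x <- eigenvalues A) h x = \sum_i h (d i).
Proof. by case=> _ _ /(perm_big _) ->; rewrite big_map big_enum. Qed.

Lemma eigenvalues_count (R : rcfType) n (A : 'M[R]_n) P d (a : pred R) :
  spectral_dec A P d -> count a (eigenvalues A) = #|[set i | a (d i)]|.
Proof.
case=> _ _ /seq.permP ->; rewrite count_map -sum1_count big_enum_cond -sum1_card.
by apply: eq_bigl => i; rewrite inE.
Qed.

(** * Power sums of the spectrum as traces *)

Section PowerSums.
Variables (R : rcfType) (n : nat) (A : 'M[R]_n).
Hypothesis symA : A^T = A.

Lemma eigenvalues_sum1 : \sum_(x <- eigenvalues A) x = \tr A.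
Proof.
have [P [d sA]] := spectral_decP symA.
rewrite (eigenvalues_sum id sA); case: sA => /unitarymxP uP AE _.
apply: (fmorph_inj (real_complex R)).
rewrite -trace_map_mx AE mxtrace_mulC mulmxA uP mul1mx mxtrace_diag rmorph_sum.
by apply: eq_bigr => i _; rewrite mxE.
Qed.

Lemma eigenvalues_sum2 : \sum_(x <- eigenvalues A) x ^+ 2 = \tr (A *m A).
Proof.
have [P [d sA]] := spectral_decP symA.
rewrite (eigenvalues_sum (fun x => x ^+ 2) sA).
case: sA => /unitarymxP uP AE _.
apply: (fmorph_inj (real_complex R)).
rewrite -trace_map_mx map_mxM AE -!mulmxA.
rewrite (mulmxA P) uP mul1mx mxtrace_mulC -!mulmxA uP mulmx1 mulmx_diag.
rewrite mxtrace_diag rmorph_sum.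
by apply: eq_bigr => i _; rewrite !mxE rmorphXn.
Qed.

Lemma eigenvalues_sum3 : \sum_(x <- eigenvalues A) x ^+ 3 = \tr (A *m A *m A).
Proof.
have [P [d sA]] := spectral_decP symA.
rewrite (eigenvalues_sum (fun x => x ^+ 3) sA).
case: sA => /unitarymxP uP AE _.
apply: (fmorph_inj (real_complex R)).
rewrite -trace_map_mx !map_mxM AE -!mulmxA !(mulmxA P) uP !mul1mx.
rewrite mxtrace_mulC -!mulmxA uP mulmx1 !mulmx_diag.
rewrite mxtrace_diag rmorph_sum.
by apply: eq_bigr => i _; rewrite !mxE !rmorphXn /= !exprS expr0 mulr1.
Qed.

End PowerSums.

(** Dimension count: the columns selected by [S1] and [S2] form a matrix with fewer columns than its
    [n] rows, so its left kernel is nonzero. *)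
Lemma exists_vanishing (F : fieldType) n p q (M1 : 'M[F]_(n, p))
    (M2 : 'M[F]_(n, q)) (S1 : {set 'I_p}) (S2 : {set 'I_q}) :
  (#|S1| + #|S2| < n)%N ->
  exists z : 'rV[F]_n, [/\ z != 0, forall j, j \in S1 -> (z *m M1) 0 j = 0
    & forall j, j \in S2 -> (z *m M2) 0 j = 0].
Proof.
move=> lt_n.
pose M := row_mx (colsub (fun j : 'I_#|S1| => enum_val j) M1)
                 (colsub (fun j : 'I_#|S2| => enum_val j) M2).
have : kermx M != 0.
  rewrite kermx_eq0; apply/negP => /eqP rkM.
  by have := rank_leq_col M; rewrite rkM leqNgt lt_n.
case/rowV0Pn => z /sub_kermxP zM z0; exists z; split=> // j jS.
  have /rowP/(_ (lshift _ (enum_rank_in jS j))) := zM.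
  rewrite mul_mx_row row_mxEl !mxE => E; rewrite -[RHS]E.
  by apply: eq_bigr => i _; rewrite mxE enum_rankK_in.
have /rowP/(_ (rshift _ (enum_rank_in jS j))) := zM.
rewrite mul_mx_row row_mxEr !mxE => E; rewrite -[RHS]E.
by apply: eq_bigr => i _; rewrite mxE enum_rankK_in.
Qed.

(** * Quadratic forms in the eigenbasis *)

Section QuadraticForm.
Variables (R : rcfType) (n : nat) (A : 'M[R]_n) (P : 'M[R[i]]_n) (d : 'I_n -> R).
Hypothesis sA : spectral_dec A P d.

Lemma spectral_form (v : 'rV[R[i]]_n) :
  (v *m map_mx (real_complex R) A *m v^t*) 0 0 =
  \sum_i (d i)%:C * `|(v *m P^t*) 0 i| ^+ 2.
Proof.
have [_ -> _] := sA; set y := v *m P^t*.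
have -> : v *m (P^t* *m diag_mx (\row_i (d i)%:C) *m P) *m v^t* =
          y *m diag_mx (\row_i (d i)%:C) *m y^t*.
  by rewrite /y trmx_mul map_mxM trmxCK !mulmxA.
rewrite mul_mx_diag mxE; apply: eq_bigr => i _; rewrite normCK.
by rewrite !mxE mulrA; congr (_ * _); rewrite mulrC.
Qed.

Lemma spectral_norm (v : 'rV[R[i]]_n) :
  (v *m v^t*) 0 0 = \sum_i `|(v *m P^t*) 0 i| ^+ 2.
Proof.
have [uP _ _] := sA; set y := v *m P^t*.
have -> : v *m v^t* = y *m y^t*.
  by rewrite /y trmx_mul map_mxM trmxCK mulmxA mulmxKtV.
by rewrite mxE; apply: eq_bigr => i _; rewrite !mxE normCK.
Qed.

Lemma spectral_form_sub (v : 'rV[R[i]]_n) (t : R) :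
  (v *m map_mx (real_complex R) A *m v^t*) 0 0 - t%:C * (v *m v^t*) 0 0 =
  \sum_i (d i - t)%:C * `|(v *m P^t*) 0 i| ^+ 2.
Proof.
rewrite spectral_form spectral_norm mulr_sumr -sumrB.
by apply: eq_bigr => i _; rewrite rmorphB mulrBl.
Qed.

(** With [y] the coordinates of [v] in the eigenbasis, the difference is the sum of
    [(d i - t) |y_i|^2]. The hypothesis makes every term nonnegative, and all of them vanish only if
    [y = 0], which [v != 0] excludes because [P] is unitary. *)
Lemma spectral_form_gt0 (v : 'rV[R[i]]_n) (t : R) :
  v != 0 -> (forall i, d i <= t -> (v *m P^t*) 0 i = 0) ->
  0 < (v *m map_mx (real_complex R) A *m v^t*) 0 0 - t%:C * (v *m v^t*) 0 0.
Proof.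
move=> v0 van; rewrite spectral_form_sub.
have ge0 i : 0 <= (d i - t)%:C * `|(v *m P^t*) 0 i| ^+ 2.
  have [/van ->|lt] := leP (d i) t; first by rewrite normr0 expr0n mulr0.
  by rewrite mulr_ge0 ?exprn_ge0 // ler0c subr_ge0 ltW.
rewrite lt_neqAle sumr_ge0 // andbT eq_sym psumr_eq0 //.
apply: contra v0 => /allP y0; have [uP _ _] := sA.
suff y00 : v *m P^t* = 0 by rewrite -(mulmxKtV v uP) // y00 mul0mx.
apply/rowP => i; rewrite [RHS]mxE.
have [/van //|lt] := leP (d i) t.
have := y0 i (mem_index_enum _); rewrite /= mulf_eq0 expf_eq0 /= normr_eq0.
case/orP => [|/eqP //]; rewrite -(rmorph0 (real_complex R)).
by rewrite (inj_eq (fmorph_inj _)) subr_eq0 gt_eqF.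
Qed.

Lemma spectral_form_le0 (v : 'rV[R[i]]_n) (t : R) :
  (forall i, t < d i -> (v *m P^t*) 0 i = 0) ->
  (v *m map_mx (real_complex R) A *m v^t*) 0 0 - t%:C * (v *m v^t*) 0 0 <= 0.
Proof.
move=> van; rewrite spectral_form_sub; apply: sumr_le0 => i _.
have [le|/van ->] := leP (d i) t; last by rewrite normr0 expr0n mulr0.
by rewrite mulr_le0_ge0 ?exprn_ge0 // lecR subr_le0.
Qed.

End QuadraticForm.

(** * Cauchy interlacing *)

(** If every eigenvalue exceeded [t], the form minus [t] times the squared norm would be positive at
    [u]. Test vectors thus bound the least eigenvalue from above. *)
Lemma rayleigh_eigenvalue (R : rcfType) n (A : 'M[R]_n) (u : 'rV[R]_n) t :
  A^T = A -> u != 0 -> (u *m A *m u^T) 0 0 <= t * (u *m u^T) 0 0 ->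
  exists2 x, x \in eigenvalues A & x <= t.
Proof.
move=> symA u0 le_t; have [P [d sA]] := spectral_decP symA.
have [[i le_i]|no] : (exists i, d i <= t) \/ (forall i, ~~ (d i <= t)).
  case: (boolP [exists i, d i <= t]) => [/existsP|/existsPn]; by [left|right].
  exists (d i) => //; have [_ _ /perm_mem ->] := sA.
  by apply: map_f; rewrite mem_enum.
pose v := map_mx (real_complex R) u.
have vt : v^t* = map_mx (real_complex R) u^T.
  by apply/matrixP => i j; rewrite !mxE [LHS]conjc_real.
have v0 : v != 0 by rewrite map_mx_eq0.
have := spectral_form_gt0 sA v0 (t := t) (fun i le_i => False_ind _ (negP (no i) le_i)).
rewrite vt -!map_mxM [X in X - _]mxE [X in _ * X]mxE -rmorphM -rmorphB => lt_t.
have {}lt_t := etrans (esym (ltcR 0 _)) lt_t; rewrite subr_gt0 in lt_t.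
by rewrite ltNge le_t in lt_t.
Qed.

Section Bordering.
Variables (R : rcfType) (n : nat) (c : 'M[R]_1) (a : 'rV[R]_n) (B : 'M[R]_n).
Hypotheses (symc : c^T = c) (symB : B^T = B).
Let A : 'M[R]_(1 + n) := block_mx c a a^T B.

Lemma bordered_sym : A^T = A.
Proof. by rewrite /A tr_block_mx trmxK symc symB. Qed.

Let padded (w : 'rV[R[i]]_n) : 'rV_(1 + n) := row_mx 0 w.

Lemma padded_form w :
  padded w *m map_mx (real_complex R) A *m (padded w)^t* =
  w *m map_mx (real_complex R) B *m w^t*.
Proof.
rewrite /padded /A map_block_mx mul_row_block !mul0mx !add0r tr_row_mx map_col_mx.
by rewrite trmx0 map_mx0 mul_row_col mulmx0 add0r.
Qed.

Lemma padded_norm w : padded w *m (padded w)^t* = w *m w^t*.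
Proof.
rewrite /padded tr_row_mx map_col_mx.
by rewrite trmx0 map_mx0 mul_row_col mulmx0 add0r.
Qed.

Lemma padded_eq0 w : (padded w == 0) = (w == 0).
Proof. by rewrite /padded row_mx_eq0 eqxx. Qed.

(** Were the count larger for [B], a dimension count would give a nonzero vector spanned by
    eigenvectors of [B] for eigenvalues at most [t], whose padding has no component along those of
    [A]. The two forms agree on it, but their signs are incompatible. *)
Lemma interlacing_le t :
  (count (<= t) (eigenvalues B) <= count (<= t) (eigenvalues A))%N.
Proof.
have [P [d sB]] := spectral_decP symB.
have [P' [d' sA]] := spectral_decP bordered_sym.
rewrite (eigenvalues_count _ sB) (eigenvalues_count _ sA) leqNgt.
set J' := [set i | _]; set J := [set i | _]; apply/negP => ltJ.
(* [z] holds coordinates in the eigenbasis of [B]: the vector itself is [z *m P], and the second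
   matrix yields the coordinates of its padding in the eigenbasis of [A]. *)
have [] := @exists_vanishing _ _ _ _ 1%:M (row_mx 0 P *m P'^t*) (~: J) J' _.
  by rewrite -[X in (_ < X)%N](card_ord n) -(cardsC J) addnC ltn_add2r.
move=> z [z0 zJ zJ'].
have [uP _ _] := sB.
have zP : z *m P *m P^t* = z by rewrite mulmxtVK.
have zP0 : z *m P != 0 by apply: contra z0 => /eqP zP0; rewrite -zP zP0 mul0mx.
have : 0 < (padded (z *m P) *m map_mx (real_complex R) A *m (padded (z *m P))^t*) 0 0
    - t%:C * (padded (z *m P) *m (padded (z *m P))^t*) 0 0.
  apply: (spectral_form_gt0 sA); first by rewrite padded_eq0.
  move=> i le_i; rewrite -(zJ' i) ?inE // mulmxA mul_mx_row.
  by rewrite mulmx0.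
rewrite padded_form padded_norm => /lt_geF/negP; apply.
apply: (spectral_form_le0 sB) => i lt_i.
by rewrite zP -(zJ i) ?mulmx1 // !inE -ltNge.
Qed.

Lemma interlacing_gt t :
  (count (> t) (eigenvalues B) <= count (> t) (eigenvalues A))%N.
Proof.
have [P [d sB]] := spectral_decP symB.
have [P' [d' sA]] := spectral_decP bordered_sym.
rewrite (eigenvalues_count _ sB) (eigenvalues_count _ sA) leqNgt.
set J' := [set i | _]; set J := [set i | _]; apply/negP => ltJ.
have [] := @exists_vanishing _ _ _ _ 1%:M (row_mx 0 P *m P'^t*) (~: J) J' _.
  by rewrite -[X in (_ < X)%N](card_ord n) -(cardsC J) addnC ltn_add2r.
move=> z [z0 zJ zJ'].
have [uP _ _] := sB.
have zP : z *m P *m P^t* = z by rewrite mulmxtVK.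
have zP0 : z *m P != 0 by apply: contra z0 => /eqP zP0; rewrite -zP zP0 mul0mx.
have : (padded (z *m P) *m map_mx (real_complex R) A *m (padded (z *m P))^t*) 0 0
    - t%:C * (padded (z *m P) *m (padded (z *m P))^t*) 0 0 <= 0.
  apply: (spectral_form_le0 sA) => i lt_i.
  rewrite -(zJ' i) ?inE // mulmxA mul_mx_row.
  by rewrite mulmx0.
rewrite padded_form padded_norm => /le_gtF/negP; apply.
apply: (spectral_form_gt0 sB) => // i le_i.
by rewrite zP -(zJ i) ?mulmx1 // !inE -leNgt.
Qed.

(** Complement of [interlacing_gt]; the successor accounts for the one additional eigenvalue of
    [A]. *)
Lemma interlacing_le_succ t :
  (count (<= t) (eigenvalues A) <= (count (<= t) (eigenvalues B)).+1)%N.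
Proof.
have := interlacing_gt t; rewrite !count_le_gt !size_eigenvalues ?bordered_sym //.
have := count_size (> t) (eigenvalues B).
have := count_size (> t) (eigenvalues A).
rewrite !size_eigenvalues ?bordered_sym // => leA leB le.
by rewrite -subSn //; apply: leq_sub2l.
Qed.

End Bordering.

(** * Monotone traces of interlacing sequences *)

Lemma lt_count_le_nth (R : realDomainType) (s : seq R) i :
  sorted <=%R s -> (i < size s)%N -> (i < count (<= (nth 0 s i : R))%R s)%N.
Proof.
move=> s_sorted i_s; rewrite ltnNge; apply/negP => le_i.
have /(_ 0 s i s_sorted) := @nth_count_gt _ _ (nth 0 s i).
by rewrite le_i i_s ltxx => /(_ isT).
Qed.

Section Interlacing.
Variables (R : realDomainType) (l m : seq R).
Hypotheses (size_lm : size l = (size m).+1)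
  (count_ml : forall t, (count (<= t)%R m <= count (<= t)%R l)%N)
  (count_lm : forall t, (count (<= t)%R l <= (count (<= t)%R m).+1)%N).

Definition trace_diff (h : R -> R) := \sum_(x <- l) h x - \sum_(x <- m) h x.

Let l' := sort <=%R l.
Let m' := sort <=%R m.

Let sorted_l' : sorted <=%R l'. Proof. exact/sort_sorted/le_total. Qed.
Let sorted_m' : sorted <=%R m'. Proof. exact/sort_sorted/le_total. Qed.

Let count_l' t : count (<= t)%R l' = count (<= t)%R l.
Proof. by apply/seq.permP; rewrite perm_sort. Qed.
Let count_m' t : count (<= t)%R m' = count (<= t)%R m.
Proof. by apply/seq.permP; rewrite perm_sort. Qed.

Lemma trace_diff_sort h : trace_diff h =
  \sum_(i < (size m).+1) h l'`_i - \sum_(i < size m) h m'`_i.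
Proof.
rewrite /trace_diff -(perm_big _ (permEl (perm_sort <=%R l))).
rewrite -[in X in _ - X](perm_big _ (permEl (perm_sort <=%R m))) /=.
by rewrite (big_nth 0) [X in _ - X](big_nth 0) !big_mkord !size_sort size_lm.
Qed.

(** At least [i + 1] entries of [m] are at most [m'_i], hence so are at least [i + 1] entries of
    [l]. *)
Lemma interlacing_nth_le i : (i < size m)%N -> l'`_i <= m'`_i.
Proof.
move=> i_m; apply: nth_count_le => //; rewrite count_l'.
apply: leq_trans (count_ml _); rewrite -count_m'.
by apply: lt_count_le_nth; rewrite ?size_sort.
Qed.

(** At least [i + 2] entries of [l] are at most [l'_(i+1)], and the count for [m] is lower by at
    most one. *)
Lemma interlacing_nth_ge i : (i < size m)%N -> m'`_i <= l'`_i.+1.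
Proof.
move=> i_m; apply: nth_count_le => //; rewrite count_m' -ltnS.
apply: leq_trans (count_lm _); rewrite -count_l'.
by apply: lt_count_le_nth; rewrite // size_sort size_lm.
Qed.

(** Pair [m'_i] with [l'_(i+1)]: each pair contributes at least 0, and the unpaired smallest entry
    of [l] at least [c]. *)
Lemma trace_diff_nondecreasing h c :
  {homo h : x y / x <= y} -> (forall x, c <= h x) -> c <= trace_diff h.
Proof.
move=> h_homo h_ge; rewrite trace_diff_sort big_ord_recl -addrA -sumrB.
rewrite -[c]addr0 lerD // sumr_ge0 // => i _.
by rewrite subr_ge0 h_homo // interlacing_nth_ge.
Qed.

(** Here [m'_i] is paired with [l'_i], and the unpaired entry is the largest of [l]. *)
Lemma trace_diff_nonincreasing h c :
  {homo h : x y / x <= y >-> y <= x} -> (forall x, c <= h x) -> c <= trace_diff h.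
Proof.
move=> h_homo h_ge; rewrite trace_diff_sort big_ord_recr addrAC -sumrB /=.
rewrite -[c]add0r lerD // sumr_ge0 // => i _.
by rewrite subr_ge0 h_homo // interlacing_nth_le.
Qed.

Lemma trace_diffD h k : trace_diff (fun x => h x + k x) = trace_diff h + trace_diff k.
Proof. by rewrite /trace_diff !big_split /= opprD addrACA. Qed.

Lemma trace_diffZ b h : trace_diff (fun x => b * h x) = b * trace_diff h.
Proof. by rewrite /trace_diff -!mulr_sumr mulrBr. Qed.

Lemma trace_diff_cst b : trace_diff (fun => b) = b.
Proof.
rewrite /trace_diff !big_const_seq !count_predT size_lm !iter_addr_0.
by rewrite mulrS addrK.
Qed.

Lemma eq_trace_diff h k : h =1 k -> trace_diff h = trace_diff k.
Proof. by move=> hk; congr (_ - _); apply: eq_bigr => x _. Qed.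

(** Split [h x = h (max x a) + h (min x a) - h a]. The first two functions are monotone with minimum
    [h a], and the constant contributes [- h a] because [l] has one entry more than [m]. *)
Lemma trace_diff_valley h a :
  (forall x y, a <= x -> x <= y -> h x <= h y) ->
  (forall x y, y <= a -> x <= y -> h y <= h x) ->
  h a <= trace_diff h.
Proof.
move=> h_incr h_decr.
have -> : trace_diff h = trace_diff (fun x => h (Num.max x a)) +
    (trace_diff (fun x => h (Num.min x a)) + trace_diff (fun=> - h a)).
  rewrite -!trace_diffD; apply: eq_trace_diff => x.
  by case: (leP x a) => _; rewrite ?subrr ?addr0 // addrC subrK.
rewrite trace_diff_cst.
have up : h a <= trace_diff (fun x => h (Num.max x a)).
  apply: trace_diff_nondecreasing => [x y xy|x]; apply: h_incr.
  - by rewrite le_max lexx orbT.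
  - by rewrite ge_max !le_max xy lexx orbT.
  - exact: lexx.
  - by rewrite le_max lexx orbT.
have down : h a <= trace_diff (fun x => h (Num.min x a)).
  apply: trace_diff_nonincreasing => [x y xy|x]; apply: h_decr.
  - by rewrite ge_min lexx orbT.
  - by rewrite le_min !ge_min xy lexx orbT.
  - exact: lexx.
  - by rewrite ge_min lexx orbT.
lra.
Qed.

End Interlacing.

(** * Gain in the negative cubes *)

Section Cubic.
Variable R : realFieldType.
Implicit Types s t : R.

(** The critical points are 0 and 1, with values 0 and -1: it increases up to 0, decreases on
    [[0, 1]] and increases afterwards. *)
Definition cubic s : R := 2 * s ^+ 3 - 3 * s ^+ 2.

Lemma cubicB s t : cubic t - cubic s =
  (t - s) * (2 * (t ^+ 2 + t * s + s ^+ 2) - 3 * (t + s)).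
Proof. by rewrite /cubic; ring. Qed.

Lemma cubic_decr s t : 0 <= s -> s <= t -> t <= 1 -> cubic t <= cubic s.
Proof.
move=> s0 st t1; rewrite -subr_le0 cubicB mulr_ge0_le0 ?subr_ge0 //.
have t0 := le_trans s0 st; have s1 := le_trans st t1.
have : 0 <= t * (1 - t) by rewrite mulr_ge0 ?subr_ge0.
have : 0 <= s * (1 - s) by rewrite mulr_ge0 ?subr_ge0.
have : 0 <= s * (1 - t) by rewrite mulr_ge0 ?subr_ge0.
lra.
Qed.

Lemma cubic_incr1 s t : 1 <= s -> s <= t -> cubic s <= cubic t.
Proof.
move=> s1 st; rewrite -subr_ge0 cubicB mulr_ge0 ?subr_ge0 //.
have t1 := le_trans s1 st.
have : 0 <= t * (t - 1) by rewrite mulr_ge0 ?subr_ge0 // (le_trans ler01).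
have : 0 <= s * (s - 1) by rewrite mulr_ge0 ?subr_ge0 // (le_trans ler01).
have : 0 <= s * (t - 1) by rewrite mulr_ge0 ?subr_ge0 // (le_trans ler01).
have : 0 <= t * (s - 1) by rewrite mulr_ge0 ?subr_ge0 // (le_trans ler01).
lra.
Qed.

Lemma cubic_incr0 s t : s <= t -> t <= 0 -> cubic s <= cubic t.
Proof.
move=> st t0; rewrite -subr_ge0 cubicB mulr_ge0 ?subr_ge0 //.
have s0 := le_trans st t0.
have := sqr_ge0 t; have := sqr_ge0 s.
have : 0 <= t * s by rewrite mulr_le0.
lra.
Qed.

End Cubic.

Definition posp (R : realDomainType) (x : R) := Num.max x 0.
Definition negp (R : realDomainType) (x : R) := Num.max (- x) 0.

Lemma posp_ge0 (R : realDomainType) (x : R) : 0 <= posp x.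
Proof. by rewrite le_max lexx orbT. Qed.

Lemma negp_ge0 (R : realDomainType) (x : R) : 0 <= negp x.
Proof. by rewrite le_max lexx orbT. Qed.

Lemma le_posp (R : realDomainType) : {homo @posp R : x y / x <= y}.
Proof. by move=> x y xy; rewrite ge_max !le_max xy lexx orbT. Qed.

Lemma le_negp (R : realDomainType) : {homo @negp R : x y / x <= y >-> y <= x}.
Proof. by move=> x y xy; rewrite ge_max !le_max lerN2 xy lexx orbT. Qed.

(** Without the filter the energy is the sum of a single function over the spectrum, the form to
    which [trace_diff] applies. *)
Lemma neg_cube_sum (R : realDomainType) (s : seq R) :
  \sum_(x <- s | x < 0) `|x| ^+ 3 = \sum_(x <- s) negp x ^+ 3.
Proof.
rewrite [RHS](bigID (fun x => x < 0)) /= [X in _ = _ + X]big1 => [|x].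
  rewrite addr0; apply: eq_bigr => x x0.
  by rewrite ltr0_norm // /negp max_l // oppr_ge0 ltW.
by rewrite -leNgt => x0; rewrite /negp max_r ?oppr_le0 // expr0n.
Qed.

Section Gain.
Variables (R : realFieldType) (l m : seq R) (d : R).
Hypotheses (size_lm : size l = (size m).+1)
  (count_ml : forall t, (count (<= t)%R m <= count (<= t)%R l)%N)
  (count_lm : forall t, (count (<= t)%R l <= (count (<= t)%R m).+1)%N).

Let D := trace_diff l m.

Let valley := trace_diff_valley size_lm count_ml count_lm.

(** As a function of [x] this is a valley with bottom at -1, where [negp] is 1. *)
Lemma negp_cubic_ge : - 1 <= D (fun x => cubic (negp x)).
Proof.
have -> : - 1 = cubic (negp (- 1 : R)).
  by rewrite /negp opprK max_l ?ler01 // /cubic; ring.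
have n1 : negp (- 1 : R) = 1 by rewrite /negp opprK max_l ?ler01.
apply: (valley (h := fun x => cubic (negp x))) => x y x1 xy.
  apply: cubic_decr; rewrite ?negp_ge0 ?le_negp //.
  by rewrite -n1 le_negp.
by apply: cubic_incr1; rewrite ?le_negp // -n1 le_negp.
Qed.

(** On [s >= 0] the function [s^3 - 3 s] is least at [s = 1], so the valley again has its bottom at
    -1. *)
Lemma negp_cube_ge : - 2 <= D (fun x => negp x ^+ 3 - 3 * negp x).
Proof.
have n1 : negp (- 1 : R) = 1 by rewrite /negp opprK max_l ?ler01.
have -> : - 2 = negp (- 1 : R) ^+ 3 - 3 * negp (- 1 : R).
  by rewrite n1; ring.
have E (s t : R) : t ^+ 3 - 3 * t - (s ^+ 3 - 3 * s) =
  (t - s) * (t ^+ 2 + t * s + s ^+ 2 - 3) by ring.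
apply: (valley (h := fun x => negp x ^+ 3 - 3 * negp x)) => x y x1 xy.
  rewrite -subr_ge0 E -mulrNN mulr_ge0 ?oppr_ge0 ?subr_le0 ?le_negp //.
  have le1 : negp x <= 1 by rewrite -n1 le_negp.
  have := negp_ge0 y; have := le_negp xy; nra.
rewrite -subr_ge0 E mulr_ge0 ?subr_ge0 ?le_negp //.
have le1 : 1 <= negp y by rewrite -n1 le_negp.
have := le_negp xy; nra.
Qed.

(** The shift moves the critical points to [d - 1] and [d]. For integer [d] these are the largest
    eigenvalues of [K_d] and [K_(d+1)], and passing from the first graph to the second gives
    equality. *)
Lemma posp_cubic_ge : 1 <= d ->
  cubic (1 - d) - 1 <= D (fun x => cubic (posp x - (d - 1))).
Proof.
move=> d1; pose s x := posp x - (d - 1).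
have le_s x y : x <= y -> s x <= s y by move=> /le_posp; rewrite lerD2r.
have sd : s d = 1 by rewrite /s /posp max_l ?(le_trans ler01) //; ring.
(* Since [cubic 0 = 0], the function splits into a nondecreasing part, least where [posp x = 0], and
   a valley with bottom at [d]. *)
have -> : D (fun x => cubic (posp x - (d - 1))) =
    D (fun x => cubic (Num.min (s x) 0)) + D (fun x => cubic (Num.max (s x) 0)).
  rewrite -trace_diffD; apply: eq_trace_diff => x; rewrite -/(s x).
  by case: (leP (s x) 0) => _; rewrite {2 3}/cubic ?expr0n ?mulr0 ?subr0 ?addr0 ?add0r.
have low : cubic (1 - d) <= D (fun x => cubic (Num.min (s x) 0)).
  apply: (trace_diff_nondecreasing size_lm count_lm) => [x y xy|x].
    apply: cubic_incr0; last by rewrite ge_min lexx orbT.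
    by rewrite le_min !ge_min le_s // lexx orbT.
  apply: cubic_incr0; last by rewrite ge_min lexx orbT.
  by rewrite le_min subr_le0 d1 andbT /s; have := posp_ge0 x; lra.
have up : - 1 <= D (fun x => cubic (Num.max (s x) 0)).
  have -> : - 1 = cubic (Num.max (s d) 0) by rewrite sd max_l ?ler01 // /cubic; ring.
  apply: (valley (h := fun x => cubic (Num.max (s x) 0))) => x y dx xy.
    apply: cubic_incr1.
      by rewrite le_max -{1}sd le_s.
    by rewrite ge_max !le_max le_s // lexx orbT.
  apply: cubic_decr; first by rewrite le_max lexx orbT.
    by rewrite ge_max !le_max le_s // lexx orbT.
  by rewrite ge_max ler01 andbT -sd le_s.
by rewrite lerD.
Qed.

Lemma neg_cube_gain : 1 <= d -> D id = 0 -> D (fun x => x ^+ 2) = 2 * d ->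
  D (fun x => x ^+ 3) <= 3 * d * (d - 1) -> 1 <= D (fun x => negp x ^+ 3).
Proof.
move=> d1 D1 D2 D3.
pose a k := D (fun x => negp x ^+ k); pose b k := D (fun x => posp x ^+ k).
have split3 (h f g : R -> R) (al be : R) :
    (forall x, h x = al * f x + be * g x) -> D h = al * D f + be * D g.
  by move=> hE; rewrite /D -!trace_diffZ -trace_diffD; apply: eq_trace_diff.
have posneg (x : R) : (posp x = 0 /\ negp x = - x) \/ (posp x = x /\ negp x = 0).
  rewrite /posp /negp; case: (leP x 0) => x0; [left|right].
    by rewrite max_l ?oppr_ge0.
  by rewrite max_r ?oppr_le0 ?ltW.
have a1 : 0 = 1 * b 1%N + (- 1) * a 1%N.
  by rewrite -D1; apply: split3 => x; case: (posneg x) => -[-> ->]; ring.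
have a2 : 2 * d = 1 * b 2%N + 1 * a 2%N.
  by rewrite -D2; apply: split3 => x; case: (posneg x) => -[-> ->]; ring.
have a3 : D (fun x => x ^+ 3) = 1 * b 3%N + (- 1) * a 3%N.
  by apply: split3 => x; case: (posneg x) => -[-> ->]; ring.
have i1 := negp_cubic_ge.
rewrite (split3 _ (fun x => negp x ^+ 3) (fun x => negp x ^+ 2) 2 (- 3)) in i1; last first.
  by move=> x; rewrite /cubic; ring.
have i2 := posp_cubic_ge d1.
have E2 : D (fun x => cubic (posp x - (d - 1))) =
    2 * b 3%N - 3 * (2 * d - 1) * b 2%N + 6 * d * (d - 1) * b 1%N + cubic (1 - d).
  rewrite -[cubic (1 - d)](trace_diff_cst size_lm) /b /D -mulNr.
  rewrite -!trace_diffZ -!trace_diffD.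
  by apply: eq_trace_diff => x; rewrite /cubic; ring.
have i3 := negp_cube_ge.
rewrite (split3 _ (fun x => negp x ^+ 3) (fun x => negp x ^+ 1) 1 (- 3)) in i3; last first.
  by move=> x; ring.
rewrite -/(a 1%N) -/(a 2%N) -/(a 3%N) in i1 i3 *.
have [m1|m1] := leP 1 (a 1%N); first lra.
rewrite E2 in i2.
have p1 : 0 <= (d - 1) * d * (1 - a 1%N).
  by rewrite !mulr_ge0 ?subr_ge0 ?(ltW m1) // (le_trans ler01).
(* The weight [2 * d - 1] gives [a 2] and [b 2] equal coefficients, so only their sum [2 * d]
   matters. Bounding [b 3] by [3 * d * (d - 1) + a 3] and [a 1] through [p1] leaves
   [4 * d * (a 3 - 1) >= 0]. *)
have p2 : 0 <= (2 * d - 1) * (2 * a 3%N - 3 * a 2%N + 1) by rewrite mulr_ge0 //; lra.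
suff : 0 <= d * (a 3%N - 1) by rewrite pmulr_rge0 ?subr_ge0 // (lt_le_trans ltr01).
nra.
Qed.

End Gain.

(** * Adding a vertex *)

(** A matrix version of [neg_energy] for exponent 3, so that induced subgraphs need no graph
    structure of their own. *)
Definition neg_cube_energy (R : rcfType) n (A : 'M[R]_n) : R :=
  \sum_(x <- eigenvalues A | x < 0) `|x| ^+ 3.

Section BorderedTraces.
Variables (R : comPzRingType) (n : nat) (a : 'rV[R]_n) (B : 'M[R]_n).
Let A : 'M[R]_(1 + n) := block_mx 0 a a^T B.

Lemma bordered_tr1 : \tr A = \tr B.
Proof. by rewrite /A mxtrace_block mxtrace0 add0r. Qed.

Lemma bordered_tr2 : \tr (A *m A) = \tr (B *m B) + (a *m a^T) 0 0 *+ 2.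
Proof.
rewrite /A mulmx_block mxtrace_block mul0mx add0r mxtraceD addrA.
by rewrite [\tr (a^T *m a)]mxtrace_mulC -mulr2n addrC /mxtrace big_ord1.
Qed.

(** In terms of closed walks of length 3: one through the new vertex visits it exactly once, in one
    of three positions. *)
Lemma bordered_tr3 :
  \tr (A *m A *m A) = \tr (B *m B *m B) + (a *m B *m a^T) 0 0 *+ 3.
Proof.
rewrite /A !mulmx_block mxtrace_block !mul0mx !mulmx0 !add0r !mulmxDl !mxtraceD.
rewrite [\tr (B *m a^T *m a)]mxtrace_mulC -[a^T *m a *m B]mulmxA.
rewrite [\tr (a^T *m (a *m B))]mxtrace_mulC !mulmxA.
by rewrite ![\tr (a *m _ *m _)]/mxtrace !big_ord1; ring.
Qed.

End BorderedTraces.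

Section EnergyGain.
Variables (R : rcfType) (n : nat) (a : 'rV[R]_n) (B : 'M[R]_n).
Hypotheses (symB : B^T = B) (B_le1 : forall i j, B i j <= 1)
  (B_diag : forall i, B i i = 0)
  (a01 : forall i, (a 0 i == 0) || (a 0 i == 1)) (a_neq0 : a != 0).
Let A : 'M[R]_(1 + n) := block_mx 0 a a^T B.

Let degree := (a *m a^T) 0 0.

Let degreeE : degree = \sum_i a 0 i.
Proof.
rewrite /degree mxE; apply: eq_bigr => i _; rewrite mxE.
by case/orP: (a01 i) => /eqP ->; ring.
Qed.

Let degree_ge1 : 1 <= degree.
Proof.
have /rV0Pn[i ai] := a_neq0.
have ge0 j : 0 <= a 0 j by case/orP: (a01 j) => /eqP ->.
rewrite degreeE (bigD1 i) //= -[1]addr0 lerD ?sumr_ge0 //.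
by case/orP: (a01 i) ai => /eqP ->; rewrite ?eqxx.
Qed.

(** The form sums over ordered pairs of neighbours. The zero diagonal removes the pairs with equal
    entries, and each remaining pair has weight at most 1. *)
Let triangles_le : (a *m B *m a^T) 0 0 <= degree * (degree - 1).
Proof.
have ge0 j : 0 <= a 0 j by case/orP: (a01 j) => /eqP ->.
have sq j : a 0 j * a 0 j = a 0 j by case/orP: (a01 j) => /eqP ->; ring.
rewrite degreeE mulrBr mulr1 mxE mulr_sumr -sumrB ler_sum // => j _.
rewrite !mxE [in leLHS](bigD1 j) //= B_diag mulr0 add0r.
rewrite [in leRHS](bigD1 j) //= mulrDl sq [a 0 j + _]addrC addrK.
by rewrite ler_wpM2r // ler_sum // => i _; rewrite ler_piMr.
Qed.

Lemma neg_cube_energy_bordered : neg_cube_energy B + 1 <= neg_cube_energy A.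
Proof.
have symA : A^T = A by rewrite bordered_sym // trmx0.
rewrite addrC -lerBrDr /neg_cube_energy !neg_cube_sum.
apply: (@neg_cube_gain _ _ _ degree).
- by rewrite !size_eigenvalues.
- by move=> t; apply: interlacing_le => //; rewrite trmx0.
- by move=> t; apply: interlacing_le_succ => //; rewrite trmx0.
- exact: degree_ge1.
- by rewrite /trace_diff !eigenvalues_sum1 // bordered_tr1 subrr.
- by rewrite /trace_diff !eigenvalues_sum2 // bordered_tr2 -/degree; ring.
rewrite /trace_diff !eigenvalues_sum3 // bordered_tr3.
by have := triangles_le; lra.
Qed.

End EnergyGain.

(** * Adjacency matrices indexed by tuples of vertices *)

Section TupleMatrix.
Variables (R : rcfType) (G : sgraph).

(** For a duplicate-free tuple this is the adjacency matrix of the induced subgraph; the ordering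
    turns a new head vertex into a bordering row and column. *)
Definition tuple_adj_mx n (t : n.-tuple G) : 'M[R]_n :=
  \matrix_(i, j) (adj (tnth t i) (tnth t j))%:R.

Lemma tuple_adj_mx_sym n (t : n.-tuple G) : (tuple_adj_mx t)^T = tuple_adj_mx t.
Proof. by apply/matrixP => i j; rewrite !mxE adj_sym. Qed.

Lemma tuple_adj_mx_cons n x (t : n.-tuple G) :
  tuple_adj_mx [tuple of x :: t] =
  block_mx 0 (\row_j (adj x (tnth t j))%:R) (\row_j (adj x (tnth t j))%:R)^T
    (tuple_adj_mx t) :> 'M_(1 + n).
Proof.
have shift (k : 'I_n) : tnth [tuple of x :: t] (rshift 1 k) = tnth t k.
  by rewrite !(tnth_nth x).
have head (k : 'I_1) : tnth [tuple of x :: t] (lshift n k) = x.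
  by rewrite !(tnth_nth x) ord1.
apply/matrixP => i j; rewrite mxE.
case: (split_ordP i) => i' ->; case: (split_ordP j) => j' ->;
  rewrite ?block_mxEul ?block_mxEur ?block_mxEdl ?block_mxEdr !mxE ?shift
    ?head //.
- by rewrite adj_irrefl.
- by rewrite adj_sym.
Qed.

Lemma neg_cube_energy_cons n x (t : n.-tuple G) :
  has (adj x) t ->
  neg_cube_energy (tuple_adj_mx t) + 1 <=
  neg_cube_energy (tuple_adj_mx [tuple of x :: t]).
Proof.
move=> /(has_nthP x)[k kt xk]; rewrite tuple_adj_mx_cons.
apply: neg_cube_energy_bordered.
- exact: tuple_adj_mx_sym.
- by move=> i j; rewrite mxE lern1 leq_b1.
- by move=> i; rewrite mxE adj_irrefl.
- by move=> i; rewrite mxE; case: (adj _ _); rewrite eqxx ?orbT.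
rewrite size_tuple in kt; apply/rV0Pn; exists (Ordinal kt).
by rewrite mxE (tnth_nth x) xk oner_neq0.
Qed.

(** Reordering conjugates the matrix by a permutation matrix, and [eigenvalues] depends only on the
    characteristic polynomial. *)
Lemma neg_cube_energy_perm n (t1 t2 : n.-tuple G) : perm_eq t1 t2 ->
  neg_cube_energy (tuple_adj_mx t1) = neg_cube_energy (tuple_adj_mx t2).
Proof.
case/tuple_permP => p tE; rewrite /neg_cube_energy /eigenvalues.
suff -> : char_poly (tuple_adj_mx t1) = char_poly (tuple_adj_mx t2) by [].
have -> : tuple_adj_mx t1 = invmx (perm_mx p^-1) *m tuple_adj_mx t2 *m perm_mx p^-1.
  have -> : invmx (perm_mx p^-1) = perm_mx p :> 'M[R]_n.
    by rewrite -(mulKmx (unitmx_perm R p^-1) (perm_mx p)) -perm_mxM mulVg perm_mx1 mulmx1.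
  rewrite -row_permE -col_permE; apply/matrixP => i j; rewrite !mxE.
  have tnthE k : tnth t1 k = tnth t2 (p k).
    by rewrite (tnth_nth (tnth t1 k)) tE -tnth_nth tnth_mktuple.
  by rewrite !tnthE.
exact/char_poly_similar/unitmx_perm.
Qed.

Lemma neg_energy_tuple (t : #|G|.-tuple G) : uniq t ->
  neg_energy R 3 G = neg_cube_energy (tuple_adj_mx t).
Proof.
move=> t_uniq; have -> : neg_energy R 3 G = neg_cube_energy (tuple_adj_mx (enum_tuple G)).
  rewrite /neg_energy /neg_cube_energy.
  suff -> : adj_mx R G = tuple_adj_mx (enum_tuple G) by [].
  have nthE (k : 'I_#|G|) : tnth (enum_tuple G) k = enum_val k.
    by rewrite (tnth_nth (enum_val k)) -enum_val_nth.
  by apply/matrixP => i j; rewrite !mxE !nthE.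
apply: neg_cube_energy_perm; apply: uniq_perm; rewrite ?enum_uniq // => x.
(* A duplicate-free tuple of [#|G|] vertices contains all of them. *)
have /subset_cardP/(_ (subset_predT _)) -> : #|t| = #|G|.
  by rewrite (card_uniqP t_uniq) size_tuple.
by rewrite mem_enum.
Qed.

End TupleMatrix.

(** * Graphs on four vertices *)

Lemma mem_eigenvalues (R : rcfType) n (A : 'M[R]_n) x :
  A^T = A -> (x \in eigenvalues A) = eigenvalue A x.
Proof.
by move=> /char_poly_eigenvalues AE; rewrite eigenvalue_root_char AE root_prod_XsubC.
Qed.

Section EnergyFromEigenvalues.
Variables (R : rcfType) (n : nat) (A : 'M[R]_n) (x t : R).
Hypotheses (x_eig : x \in eigenvalues A) (x_le : x <= t).

Let negp_ge : - t <= negp x.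
Proof. by rewrite le_max lerN2 x_le. Qed.

Lemma neg_cube_energy_ge1 : t <= 0 -> (- t) ^+ 3 <= neg_cube_energy A.
Proof.
move=> t0; rewrite /neg_cube_energy neg_cube_sum (perm_big _ (perm_to_rem x_eig)).
rewrite big_cons -[leLHS]addr0 lerD ?sumr_ge0 //; last first.
  by move=> y _; rewrite exprn_ge0 ?negp_ge0.
by rewrite lerXn2r // ?nnegrE ?oppr_ge0 ?negp_ge0.
Qed.

Lemma neg_cube_energy_ge2 :
  - 1 \in eigenvalues A -> t < - 1 -> (- t) ^+ 3 + 1 <= neg_cube_energy A.
Proof.
move=> eig1 t1; have t0 : t <= 0 by lra.
rewrite /neg_cube_energy neg_cube_sum (perm_big _ (perm_to_rem x_eig)) big_cons.
(* As [x <= t < -1], removing [x] leaves -1 in the list, so both eigenvalues contribute. *)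
have mem1 : - 1 \in rem x (eigenvalues A).
  have := eig1; rewrite (perm_mem (perm_to_rem x_eig)) in_cons => /orP[/eqP e1|//].
  by move: x_le t1; rewrite -e1; lra.
rewrite lerD ?(perm_big _ (perm_to_rem mem1)) ?big_cons //.
  by rewrite lerXn2r // ?nnegrE ?oppr_ge0 ?negp_ge0.
rewrite -[leLHS]addr0 lerD ?sumr_ge0 //; last first.
  by move=> y _; rewrite exprn_ge0 ?negp_ge0.
by rewrite /negp opprK max_l ?ler01 // expr1n.
Qed.

End EnergyFromEigenvalues.

Section FourVertices.
Variables (R : rcfType) (G : sgraph) (w a b c : G).
Hypotheses (ab : adj a b) (bc : adj b c) (ac : ~~ adj a c).
Let A := tuple_adj_mx R [tuple w; a; b; c].
Let ba : adj b a. Proof. by rewrite adj_sym. Qed.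
Let cb : adj c b. Proof. by rewrite adj_sym. Qed.
Let ca : adj c a = false. Proof. by rewrite adj_sym (negPf ac). Qed.

Let entryE : A = \matrix_(i, j)
  (nth [::] [:: [:: 0; (adj w a)%:R; (adj w b)%:R; (adj w c)%:R];
      [:: (adj w a)%:R; 0; 1; 0];
      [:: (adj w b)%:R; 1; 0; 1];
      [:: (adj w c)%:R; 0; 1; 0]] i)`_j.
Proof.
apply/matrixP => i j; rewrite !mxE !(tnth_nth w).
case: i => -[|[|[|[|//]]]] lt_i; case: j => -[|[|[|[|//]]]] lt_j /=;
  by rewrite ?adj_irrefl ?ab ?bc ?ba ?cb ?ca ?(negPf ac) // adj_sym.
Qed.

(** [rayleigh_eigenvalue] with both forms expanded at the test vector [(x0, x1, x2, x3)]; the sign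
    of [x0] makes that vector nonzero. *)
Lemma four_vertices_eigenvalue (x0 x1 x2 x3 t : R) :
  0 < x0 ->
  2 * (x0 * x1 * (adj w a)%:R + x0 * x2 * (adj w b)%:R + x0 * x3 * (adj w c)%:R
    + x1 * x2 + x2 * x3) <= t * (x0 ^+ 2 + x1 ^+ 2 + x2 ^+ 2 + x3 ^+ 2) ->
  exists2 x, x \in eigenvalues A & x <= t.
Proof.
move=> x0_gt0 le_t; pose u : 'rV[R]_4 := \row_i [:: x0; x1; x2; x3]`_i.
apply: (@rayleigh_eigenvalue _ _ _ u); first exact: tuple_adj_mx_sym.
  by apply/rV0Pn; exists ord0; rewrite mxE /= gt_eqF.
rewrite -/A entryE !mxE !big_ord_recl !big_ord0 !mxE !big_ord_recl !big_ord0 !mxE /=.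
by lra.
Qed.

(** The four equations say [u *m A = - u] entry by entry. The difference of the indicators of two
    adjacent vertices with the same other neighbours satisfies them. *)
Lemma four_vertices_twins (x0 x1 x2 x3 : R) :
  0 < x0 ->
  [/\ x1 * (adj w a)%:R + x2 * (adj w b)%:R + x3 * (adj w c)%:R = - x0,
      x0 * (adj w a)%:R + x2 = - x1,
      x0 * (adj w b)%:R + x1 + x3 = - x2
    & x0 * (adj w c)%:R + x2 = - x3] ->
  - 1 \in eigenvalues A.
Proof.
move=> x0_gt0 [e0 e1 e2 e3]; pose u : 'rV[R]_4 := \row_i [:: x0; x1; x2; x3]`_i.
rewrite mem_eigenvalues ?tuple_adj_mx_sym //; apply/eigenvalueP; exists u; last first.
  by apply/rV0Pn; exists ord0; rewrite mxE /= gt_eqF.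
apply/rowP => -[[|[|[|[|//]]]] lt_i]; rewrite entryE mxE !big_ord_recl big_ord0.
all: rewrite !mxE /=.
- by lra.
- by lra.
- by lra.
- by lra.
Qed.

(* The vectors approximate an eigenvector of the least eigenvalue.  That
   eigenvalue alone contributes 4, except in the paw and the diamond, where it
   contributes 3 and two adjacent twins give the further eigenvalue -1. *)
Lemma four_vertices_energy :
  [|| adj w a, adj w b | adj w c] -> 4 <= neg_cube_energy A.
Proof.
(* The cube of [8 / 5] is slightly more than 4 and that of [29 / 20] slightly more than 3. *)
have one x0 x1 x2 x3 := @four_vertices_eigenvalue x0 x1 x2 x3 (- (8 / 5)).
have two x0 x1 x2 x3 := @four_vertices_eigenvalue x0 x1 x2 x3 (- (29 / 20)).
have twin x0 x1 x2 x3 := @four_vertices_twins x0 x1 x2 x3.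
have fin1 x : x \in eigenvalues A -> x <= - (8 / 5) -> 4 <= neg_cube_energy A.
  move=> xA xt; apply: le_trans (neg_cube_energy_ge1 xA xt _); lra.
have fin2 x : x \in eigenvalues A -> x <= - (29 / 20) -> - 1 \in eigenvalues A ->
    4 <= neg_cube_energy A.
  move=> xA xt eig1; apply: le_trans (neg_cube_energy_ge2 xA xt eig1 _); lra.
move: one two twin.
(* The surviving cases are, in order: diamond, paw, 4-cycle, path, paw, star, path. *)
case: (adj w a); case: (adj w b); case: (adj w c) => //= one two twin _.
- have [||x xA xt] := two 1 (- 1) 1 (- 1); [lra | lra |].
  by apply: (fin2 x) => //; apply: (twin 1 0 (- 1) 0); [lra | split; lra].
- have [||x xA xt] := two 2 2 (- 5) 3; [lra | lra |].
  by apply: (fin2 x) => //; apply: (twin 1 (- 1) 0 0); [lra | split; lra].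
- have [||x xA xt] := one 1 (- 1) 1 (- 1); [lra | lra |].
  exact: fin1 xt.
- have [||x xA xt] := one 2 (- 3) 3 (- 2); [lra | lra |].
  exact: fin1 xt.
- have [||x xA xt] := two 2 3 (- 5) 2; [lra | lra |].
  by apply: (fin2 x) => //; apply: (twin 1 0 0 (- 1)); [lra | split; lra].
- have [||x xA xt] := one 1 1 (- 2) 1; [lra | lra |].
  exact: fin1 xt.
- have [||x xA xt] := one 2 (- 2) 3 (- 3); [lra | lra |].
  exact: fin1 xt.
Qed.

End FourVertices.

(** * Growing a connected graph *)

(** With no edge leaving [S], the set would be closed under adjacency and hence under
    connectivity. *)
Lemma connected_boundary (G : sgraph) (S : pred G) (x y : G) :
  connected_graph G -> S x -> ~~ S y -> exists z w, [/\ S z, ~~ S w & adj z w].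
Proof.
move=> conn Sx nSy.
case: (boolP [exists z, exists w, [&& S z, ~~ S w & adj z w]]).
  by case/existsP=> z /existsP[w /and3P[]]; exists z, w.
move/existsPn=> no; have adj_csym : connect_sym (@adj G).
  by apply: sym_connect_sym => u v; rewrite adj_sym.
have clS : closed (@adj G) S.
  apply: (intro_closed adj_csym) => u v uv Su; apply/negPn/negP => nSv.
  have /existsPn/(_ v) := no u; rewrite uv andbT => /negP[].
  by apply/andP.
by have := closed_connect clS (conn x y); rewrite !unfold_in Sx (negPf nSy).
Qed.

Lemma complete_graph_iso (G : sgraph) :
  (forall x y : G, x != y -> adj x y) -> graph_iso G (complete_graph #|G|).
Proof.
move=> full; exists (@enum_rank G).
  by exists enum_val; [apply: enum_rankK | apply: enum_valK].
move=> x y; rewrite /= /complete_rel (inj_eq enum_rank_inj).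
by case: eqVneq => [->|/full ->]; rewrite ?adj_irrefl.
Qed.

Lemma induced_path3 (G : sgraph) : connected_graph G ->
  ~ graph_iso G (complete_graph #|G|) ->
  exists a b c : G, [/\ a != c, adj a b, adj b c & ~~ adj a c].
Proof.
move=> conn nK.
have [/existsP[x /existsP[y /andP[xy nxy]]]|full] :=
    boolP [exists x : G, exists y : G, (x != y) && ~~ adj x y]; last first.
  case: nK; apply: complete_graph_iso => x y xy.
  move/existsPn/(_ x)/existsPn/(_ y): full.
  by rewrite negb_and xy negbK.
(* The set is the closed neighbourhood of [x]. Since [w] lies outside it, [z] is a neighbour of [x]
   and not [x] itself, so [x], [z], [w] is an induced path. *)
have [||z [w [/orP[/eqP ->|xz] + zw]]] :=
  @connected_boundary G (fun z => (z == x) || adj x z) x y conn.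
- by rewrite eqxx.
- by rewrite negb_or eq_sym xy.
- by rewrite zw orbT.
rewrite negb_or => /andP[wx nxw]; exists x, z, w; split=> //.
by rewrite eq_sym.
Qed.

(** The isomorphism sends a vertex to its index in [[:: a; b; c]]; adjacency is checked on the nine
    pairs. *)
Lemma path3_iso (G : sgraph) (a b c : G) :
  uniq [:: a; b; c] -> #|G| = 3%N -> adj a b -> adj b c -> ~~ adj a c ->
  graph_iso G (path_graph 3).
Proof.
move=> abc_uniq G3 ab bc ac.
have memG x : x \in [:: a; b; c].
  have /subset_cardP/(_ (subset_predT _)) -> // : #|[:: a; b; c]| = #|G|.
  by rewrite (card_uniqP abc_uniq).
have lt3 x : (index x [:: a; b; c] < 3)%N.
  by rewrite -[X in (_ < X)%N]/(size [:: a; b; c]) index_mem.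
exists (fun x => Ordinal (lt3 x) : path_graph 3).
  apply: inj_card_bij; last by rewrite G3 card_ord.
  move=> x y [] /(congr1 (nth a [:: a; b; c])).
  by rewrite !nth_index.
have [ba cb ca] : [/\ adj b a, adj c b & adj c a = false].
  by rewrite adj_sym ab [adj c b]adj_sym bc adj_sym (negPf ac).
move: abc_uniq; rewrite /= !inE negb_or andbT => /andP[/andP[ab' ac'] bc'].
move=> x y; rewrite /path_rel /=.
move: (memG x) (memG y); rewrite !inE.
by case/or3P => /eqP ->; case/or3P => /eqP ->;
  rewrite ?eqxx ?[b == a]eq_sym ?[c == a]eq_sym ?[c == b]eq_sym
   ?(negPf ab') ?(negPf ac') ?(negPf bc') ?eqxx ?ab ?bc ?ba ?cb ?ca
   ?(negPf ac) ?adj_irrefl.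
Qed.

Lemma exists_base_tuple (R : rcfType) (G : sgraph) : connected_graph G ->
  ~ graph_iso G (complete_graph #|G|) -> ~ graph_iso G (path_graph 3) ->
  (4 <= #|G|)%N /\
  exists2 t : 4.-tuple G, uniq t & 4 <= neg_cube_energy (tuple_adj_mx R t).
Proof.
move=> conn nK nP; have [a [b [c [ac ab bc nac]]]] := induced_path3 conn nK.
have abc_uniq : uniq [:: a; b; c].
  rewrite /= !inE negb_or ac !andbT.
  apply/andP; split; [apply: contraTneq ab | apply: contraTneq bc] => ->.
    by rewrite adj_irrefl.
  by rewrite adj_irrefl.
(* Otherwise [G] would be the path [a], [b], [c]. *)
have [y yabc] : exists y, y \notin [:: a; b; c].
  apply/existsP; rewrite -negb_forall; apply/negP => /forallP full.
  apply: nP; apply: (path3_iso abc_uniq) => //.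
  have <- : #|[:: a; b; c]| = 3%N := card_uniqP abc_uniq.
  by apply: eq_card => x; rewrite full.
(* Connectivity replaces [y] by a fourth vertex [w] that is adjacent to the path. *)
have [||z [w [zabc wabc zw]]] :=
  @connected_boundary G (mem [:: a; b; c]) a y conn.
- exact: mem_head.
- exact: yabc.
have w_uniq : uniq [tuple w; a; b; c].
  by rewrite [uniq _]/= -/(uniq [:: a; b; c]) abc_uniq andbT.
split.
  have <- : #|[tuple w; a; b; c]| = 4%N := card_uniqP w_uniq.
  exact: max_card.
exists [tuple w; a; b; c] => //; apply: four_vertices_energy => //.
rewrite ![adj w _]adj_sym.
by move: zabc zw; rewrite !inE => /or3P[] /eqP -> ->; rewrite ?orbT.
Qed.

(** Induction on [k]: by connectivity some vertex outside the tuple is adjacent to one inside, and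
    adding it raises the energy by at least 1. *)
Lemma exists_energy_tuple (R : rcfType) (G : sgraph) k : connected_graph G ->
  (exists2 t : 4.-tuple G, uniq t & 4 <= neg_cube_energy (tuple_adj_mx R t)) ->
  (4 + k <= #|G|)%N ->
  exists2 t : (4 + k).-tuple G, uniq t &
    (4 + k)%:R <= neg_cube_energy (tuple_adj_mx R t).
Proof.
move=> conn [t0 t0_uniq t0_ge]; elim: k => [|k IHk] le_k; first by exists t0.
have [|t t_uniq t_ge] := IHk; first by rewrite ltnW // -addnS.
have [y yt] : exists y, y \notin t.
  apply/existsP; rewrite -negb_forall; apply/negP => /forallP full.
  move: le_k; rewrite addnS ltnNge => /negP[].
  rewrite -(size_tuple t) -(card_uniqP t_uniq).
  by apply/eq_leq/eq_card => x; rewrite full.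
have [||z [w [zt wt zw]]] := @connected_boundary G (mem t) (tnth t ord0) y conn.
- exact: mem_tnth.
- by [].
rewrite addnS; exists [tuple of w :: t]; first by rewrite /= wt.
apply: le_trans (neg_cube_energy_cons _ _); first by rewrite -natr1 lerD2r.
by apply/hasP; exists z; rewrite // adj_sym.
Qed.

Unset Implicit Arguments.

Theorem theorem1p5 (R : realType) (n : nat) (G : sgraph) :
  (0 < n)%N ->
  #|G| = n ->
  connected_graph G ->
  ~ graph_iso G (complete_graph n) ->
  ~ graph_iso G (path_graph 3) ->
  n%:R <= neg_energy R 3 G.
Proof.
move=> _ <- conn nK nP.
have [G4 base] := exists_base_tuple R conn nK nP.
(* The truncated subtraction is exact by [G4], so the tuple obtained lists every vertex. *)
have := @exists_energy_tuple R G (#|G| - 4) conn base; rewrite subnKC //.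
by case/(_ (leqnn _)) => t t_uniq; rewrite (neg_energy_tuple _ t_uniq).
Qed.
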